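(* If a Sudoku grid $\mathcal{A}$ has a unique solution, then this solution is a logically deducible solution of $\mathcal{A}$.
   Context: A Sudoku proposition is a formal symbol $r_ic_j \not\approx d$ with $i,j,d\in\{1,\dots,9\}$. Sudoku formulas are built inductively from Sudoku propositions and the constants $\top,\bot$ using $\lnot,\land,\lor,\Rightarrow,\Leftrightarrow$. A grid is a $9\times 9$ matrix $\mathcal{A}=[A_{ij}]_{9\times 9}$ of nonempty subsets $A_{ij}\subseteq\{1,\dots,9\}$; it is full if $|A_{ij}|=1$ for all $i,j$. Satisfaction $\mathcal{A}\models\phi$: $\mathcal{A}\models\top$ always, $\mathcal{A}\models\bot$ never, $\mathcal{A}\models r_ic_j\not\approx d$ iff $d\notin A_{ij}$, and the connectives are interpreted classically. Write $r_ic_j\equiv d$ for $\bigwedge_{s\ne d} r_ic_j\not\approx s$, and $r_ic_j\parallel r_\ell c_m$ for $\bigwedge_{1\le d\le 9}((r_ic_j\equiv d\Rightarrow r_\ell c_m\not\approx d)\land(r_\ell c_m\equiv d\Rightarrow r_ic_j\not\approx d))$. The set $\Sigma_{ax}$ consists of 27 formulas, one for each row, each column and each of the nine standard $3\times 3$ boxes: the conjunction of $r_ic_j\parallel r_\ell c_m$ over all pairs of distinct cells in that row, column or box. A Sudoku grid is a grid $\mathcal{A}$ with $\mathcal{A}\models\phi$ for all $\phi\in\Sigma_{ax}$ (i.e. whenever $A_{ij}=\{d\}$, $d$ belongs to no $A_{\ell m}$ for another cell in the same row, column or box). A full Sudoku grid is a Sudoku grid that is full. A solution of a Sudoku grid $\mathcal{A}=[A_{ij}]$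 is a full Sudoku grid $\mathcal{S}=[S_{ij}]$ with $S_{ij}\subseteq A_{ij}$ for all $i,j$. A Sudoku axiom is a Sudoku formula that holds in every full Sudoku grid; $\Delta_{ax}$ is the set of all Sudoku axioms. For a set $\Phi$ of Sudoku formulas and a Sudoku formula $\alpha$, $\Phi\vdash\alpha$ means there is a finite sequence $\phi_1,\dots,\phi_n=\alpha$ of Sudoku formulas such that each $\phi_i$ is in $\Delta_{ax}$, or in $\Phi$, or is obtained by modus ponens from earlier formulas (there are $p,q<i$ with $\phi_q$ equal to $\phi_p\Rightarrow\phi_i$). $\Phi\vdash\Psi$ means $\Phi\vdash\alpha$ for all $\alpha\in\Psi$. For a Sudoku grid $\mathcal{A}$ let $\mathrm{Prop}(\mathcal{A})=\{r_ic_j\not\approx d: 1\le i,j,d\le 9,\ d\notin A_{ij}\}$. A solution $\mathcal{S}$ of $\mathcal{A}$ is a logically deducible solution of $\mathcal{A}$ if $\mathrm{Prop}(\mathcal{A})\vdash\mathrm{Prop}(\mathcal{S})$. *)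

(* Defs.v *)
From mathcomp Require Import all_boot matrix.

Set Implicit Arguments.
Unset Strict Implicit.
Unset Printing Implicit Defensive.

(* Rows, columns and digits 1..9 are all represented by 'I_9, shifted to 0..8. *)

(* [SNeq i j d] is the proposition $r_i c_j \not\approx d$. *)
Inductive sformula : Type :=
| SNeq of 'I_9 & 'I_9 & 'I_9
| STop
| SBot
| SNot of sformula
| SAnd of sformula & sformula
| SOr  of sformula & sformula
| SImp of sformula & sformula
| SIff of sformula & sformula.

(* Nonemptiness is a boolean so that grids with equal matrices are equal. *)
Record grid : Type := Grid {
  cell :> 'M[{set 'I_9}]_9;
  _ : [forall i, forall j, cell i j != set0]
}.

Definition full (A : grid) : Prop := forall i j, #|A i j| = 1.

Fixpoint sat (A : grid) (phi : sformula) : bool :=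
  match phi with
  | SNeq i j d => d \notin A i j
  | STop => true
  | SBot => false
  | SNot f => ~~ sat A f
  | SAnd f g => sat A f && sat A g
  | SOr f g => sat A f || sat A g
  | SImp f g => sat A f ==> sat A g
  | SIff f g => sat A f == sat A g
  end.

(* Finite conjunctions below are right-nested in enumeration order and end
   in [STop]. *)

(* $r_i c_j \equiv d$, with c = (i, j). *)
Definition SEq (c : 'I_9 * 'I_9) (d : 'I_9) : sformula :=
  \big[SAnd/STop]_(s : 'I_9 | s != d) SNeq c.1 c.2 s.

(* $r_i c_j \parallel r_l c_m$, with c = (i, j) and c' = (l, m). *)
Definition SPar (c c' : 'I_9 * 'I_9) : sformula :=
  \big[SAnd/STop]_(d : 'I_9)
    SAnd (SImp (SEq c d) (SNeq c'.1 c'.2 d))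
         (SImp (SEq c' d) (SNeq c.1 c.2 d)).

Definition row_cells (u : 'I_9) : {set 'I_9 * 'I_9} := [set c | c.1 == u].
Definition col_cells (u : 'I_9) : {set 'I_9 * 'I_9} := [set c | c.2 == u].
(* Boxes are numbered 0..8, three per horizontal band. *)
Definition box_cells (u : 'I_9) : {set 'I_9 * 'I_9} :=
  [set c : 'I_9 * 'I_9 | (c.1 %/ 3 * 3 + c.2 %/ 3)%N == u].

(* The conjunction ranges over ordered pairs; [SPar] is symmetric up to
   equivalence. *)
Definition unit_axiom (U : {set 'I_9 * 'I_9}) : sformula :=
  \big[SAnd/STop]_(p : ('I_9 * 'I_9) * ('I_9 * 'I_9) |
      [&& p.1 \in U, p.2 \in U & p.1 != p.2]) SPar p.1 p.2.

Definition Sigma_ax (phi : sformula) : Prop :=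
  exists u : 'I_9, [\/ phi = unit_axiom (row_cells u),
                       phi = unit_axiom (col_cells u)
                     | phi = unit_axiom (box_cells u)].

Definition sudoku_grid (A : grid) : Prop := forall phi, Sigma_ax phi -> sat A phi.

Definition full_sudoku_grid (A : grid) : Prop := sudoku_grid A /\ full A.

Definition solution (A S : grid) : Prop :=
  full_sudoku_grid S /\ forall i j, S i j \subset A i j.

Definition Delta_ax (phi : sformula) : Prop :=
  forall A : grid, full_sudoku_grid A -> sat A phi.

(* A finite sequence ending in alpha is written [rcons s alpha]; [STop] is
   only the default of [nth]. *)
Definition derivation (Phi : sformula -> Prop) (s : seq sformula) : Prop :=
  forall k, k < size s ->
    [\/ Delta_ax (nth STop s k),
        Phi (nth STop s k)
      | exists p q, [/\ p < k, q < k &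
          nth STop s q = SImp (nth STop s p) (nth STop s k)]].

Definition derives (Phi : sformula -> Prop) (alpha : sformula) : Prop :=
  exists s : seq sformula, derivation Phi (rcons s alpha).

Definition derives_all (Phi Psi : sformula -> Prop) : Prop :=
  forall alpha, Psi alpha -> derives Phi alpha.

Definition grid_props (A : grid) (phi : sformula) : Prop :=
  exists i j d, d \notin A i j /\ phi = SNeq i j d.

Definition logically_deducible_solution (A S : grid) : Prop :=
  solution A S /\ derives_all (grid_props A) (grid_props S).

(* Main.v *)
Require Import Defs.
From mathcomp Require Import all_boot matrix.

(** Only finitely many propositions p_1, ..., p_n lie in Prop(A).  A full
    Sudoku grid satisfies them all exactly when it is a solution of A, hence
    by uniqueness when it is S.  So p_1 => ... => p_n => alpha is a Sudoku
    axiom for every alpha true in S, and n applications of modus ponens derive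
    alpha from Prop(A). *)

(** The antecedents are indexed by [T] so that membership in the list can be tested on indices,
    [sformula] having no decidable equality here. *)
Definition imps {T : Type} (f : T -> sformula) (l : seq T) (alpha : sformula) :=
  foldr (fun x => SImp (f x)) alpha l.

Lemma sat_imps {T : eqType} (f : T -> sformula) (l : seq T) alpha (A : grid) :
  ({in l, forall x, sat A (f x)} -> sat A alpha) -> sat A (imps f l alpha).
Proof.
elim: l => [|x l IHl] Hl; first exact: Hl.
apply/implyP => fx; apply: IHl => Hsat; apply: Hl => y.
by rewrite inE => /predU1P [->|/Hsat].
Qed.

Section Derivations.

Variable Phi : sformula -> Prop.

Lemma derivation_cat s t :
  derivation Phi s -> derivation Phi t -> derivation Phi (s ++ t).
Proof.
move=> ds dt k; rewrite size_cat nth_cat => ltk.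
case: ltnP => [lt_ks|le_sk].
  have [?|?|[p [q [lt_pk lt_qk e]]]] := ds k lt_ks.
  - by constructor 1.
  - by constructor 2.
  by constructor 3; exists p, q; rewrite !nth_cat !(ltn_trans _ lt_ks).
have [|?|?|[p [q [lt_pk lt_qk e]]]] := dt (k - size s).
- by rewrite ltn_subLR.
- by constructor 1.
- by constructor 2.
(* Both premises lie in the block [t], whose positions are shifted by [size s] in [s ++ t]. *)
constructor 3; exists (size s + p), (size s + q); rewrite -!ltn_subRL.
by rewrite !nth_cat ![_ + _ < size s]ltnNge !leq_addr /= !addKn.
Qed.

Lemma derivation_rcons s a :
  derivation Phi s ->
  [\/ Delta_ax a, Phi a
    | exists p q, [/\ p < size s, q < size s &
        nth STop s q = SImp (nth STop s p) a]] ->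
  derivation Phi (rcons s a).
Proof.
move=> ds Ha k; rewrite size_rcons ltnS leq_eqVlt => /predU1P [->|lt_ks].
  rewrite nth_rcons ltnn eqxx; case: Ha => [?|?|[p [q [ltp ltq e]]]].
  - by constructor 1.
  - by constructor 2.
  by constructor 3; exists p, q; rewrite !nth_rcons ltp ltq.
rewrite nth_rcons lt_ks; have [?|?|[p [q [ltp ltq e]]]] := ds k lt_ks.
- by constructor 1.
- by constructor 2.
by constructor 3; exists p, q; rewrite !nth_rcons !(ltn_trans _ lt_ks).
Qed.

Lemma derives_axiom a : Delta_ax a -> derives Phi a.
Proof. by move=> ax; exists [::]; apply: derivation_rcons => //; constructor 1. Qed.

Lemma derives_hyp a : Phi a -> derives Phi a.
Proof. by move=> Ha; exists [::]; apply: derivation_rcons => //; constructor 2. Qed.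

Lemma derives_mp a b : derives Phi a -> derives Phi (SImp a b) -> derives Phi b.
Proof.
move=> [s ds] [t dt]; exists (rcons s a ++ rcons t (SImp a b)).
apply: derivation_rcons; first exact: derivation_cat.
(* [a] closes the first block, of length [(size s).+1]; [SImp a b] closes the second, at offset
   [size t] within it. *)
constructor 3; exists (size s), ((size s).+1 + size t).
split; rewrite ?size_cat ?size_rcons ?ltn_add2l //.
  by rewrite ltn_addr.
rewrite !nth_cat !size_rcons ltnSn [_ + _ < _]ltnNge leq_addr addKn /=.
by rewrite !nth_rcons !ltnn !eqxx.
Qed.

Lemma derives_imps {T : eqType} (f : T -> sformula) (l : seq T) alpha :
  {in l, forall x, Phi (f x)} -> derives Phi (imps f l alpha) ->
  derives Phi alpha.
Proof.
elim: l => //= x l IHl Hl Himp; apply: IHl.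
  by move=> y ly; apply: Hl; rewrite inE ly orbT.
by apply: derives_mp Himp; apply: derives_hyp; apply: Hl; rewrite mem_head.
Qed.

End Derivations.

Theorem theorem5p11 (A S : grid) (hA : sudoku_grid A)
    (hS : solution A S) (uniqS : forall T : grid, solution A T -> T = S) :
  logically_deducible_solution A S.
Proof.
split=> // _ [i [j [d [Sd ->]]]].
pose f (x : 'I_9 * 'I_9 * 'I_9) := SNeq x.1.1 x.1.2 x.2.
(* The triples (row, column, digit) that index Prop(A). *)
pose l := [seq x <- enum {: 'I_9 * 'I_9 * 'I_9} | x.2 \notin A x.1.1 x.1.2].
apply: (@derives_imps _ _ f l).
  by move=> [[u v] e]; rewrite mem_filter => /andP [Ae _]; exists u, v, e.
apply: derives_axiom => T fullT; apply: sat_imps => satT.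
(* In [S] the goal unfolds to the hypothesis [Sd]. *)
suff -> : T = S by [].
(* Contrapositive of the inclusion: a digit missing from [A u v] gives a proposition listed in [l],
   which [T] satisfies, so it is missing from [T u v] too. *)
apply: uniqS; split=> // u v; apply/subsetP => e; apply: contraLR => Ae.
by apply: (satT (u, v, e)); rewrite mem_filter Ae mem_enum.
Qed.
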